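(* Let $F$ be a field and let $*_\mu$ be a multiplication on the space $\mathfrak C$ of $m\times m\times m$ cubic matrices over $F$ such that the algebra $\mathfrak C_\mu=(\mathfrak C,*_\mu)$ is unital and associative. Let $\{A^{[t]},\ t\ge0\}\subset\mathfrak C_\mu$ be a family of cubic matrices that are invertible in $\mathfrak C_\mu$ for all $t$. Then the family of matrices $$\mathcal M^{[s,t]}=A^{[s]}*_\mu(A^{[t]})^{-1}$$ generates a flow of algebras (FA) of type $\mu$, where $(A^{[t]})^{-1}$ is the inverse of $A^{[t]}$.
   Context: A cubic matrix over $F$ is an array $Q=(q_{ijk})_{i,j,k=1}^m$ with entries in $F$; $\mathfrak C$ is the $m^3$-dimensional $F$-vector space of all of them (entrywise operations). A multiplication $*_\mu$ on $\mathfrak C$ is an arbitrary $F$-bilinear map $\mathfrak C\times\mathfrak C\to\mathfrak C$, and $\mathfrak C_\mu=(\mathfrak C,*_\mu)$ is the resulting algebra. Unital means there is a unit matrix $\mathbb I\in\mathfrak C_\mu$ with $\mathbb I*_\mu A=A=A*_\mu\mathbb I$ for all $A$; $A^{-1}\in\mathfrak C_\mu$ is called the inverse of $A$ if $A*_\mu A^{-1}=A^{-1}*_\mu A=\mathbb I$. A family of cubic matrices $\mathcal M^{[s,t]}=(c^{[s,t]}_{ijk})_{i,j,k=1}^m$, $0\le s\le t$ real, generates an FA (flow of algebras) of type $\mu$ if it satisfies the Kolmogorov-Chapman equation $\mathcal M^{[s,t]}=\mathcal M^{[s,\tau]}*_\mu\mathcal M^{[\tau,t]}$ for all $0\le s<\tau<t$;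 the FA is then the family of $m$-dimensional algebras $\mathcal A^{[s,t]}$ over $F$ with basis $e_1,\dots,e_m$ and products $e_ie_j=\sum_{k=1}^m c^{[s,t]}_{ijk}e_k$. *)

(* Defs.v *)
From HB Require Import structures.
From mathcomp Require Import all_boot all_order all_algebra sesquilinear.
From mathcomp Require Import boolp classical_sets reals.

Set Implicit Arguments.
Unset Strict Implicit.
Unset Printing Implicit Defensive.

Import GRing.Theory.
Local Open Scope ring_scope.

(* The codomain is the regular module F^o, so that this type carries the
   canonical structure of a vector space over F, of dimension m ^ 3; the entry
   q_ijk of Q is Q (i, j, k), with indices starting at 0. *)
Notation cubic F m := {ffun 'I_m * 'I_m * 'I_m -> F^o}.

Notation multiplication F m := {bilinear cubic F m -> cubic F m -> cubic F m}.

Definition is_unit_matrix (F : fieldType) (m : nat) (mu : multiplication F m)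
    (I : cubic F m) : Prop :=
  left_id I mu /\ right_id I mu.

Definition is_inverse (F : fieldType) (m : nat) (mu : multiplication F m)
    (I A B : cubic F m) : Prop :=
  mu A B = I /\ mu B A = I.

Definition invertible (F : fieldType) (m : nat) (mu : multiplication F m)
    (I A : cubic F m) : Prop :=
  exists B, is_inverse mu I A B.

(* Some inverse of A if there is one, and 0 otherwise; when mu is associative
   with unit matrix I, A has at most one inverse. *)
Definition inverse (F : fieldType) (m : nat) (mu : multiplication F m)
    (I A : cubic F m) : cubic F m :=
  xget 0 [set B | is_inverse mu I A B]%classic.

(* Only the values M s t with 0 <= s <= t are meaningful. *)
Definition Kolmogorov_Chapman (R : realType) (F : fieldType) (m : nat)
    (mu : multiplication F m) (M : R -> R -> cubic F m) : Prop :=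
  forall s tau t : R, 0 <= s -> s < tau -> tau < t ->
    M s t = mu (M s tau) (M tau t).

(* An algebra structure on F^m, with standard basis e_i = delta_mx 0 i. *)
Notation algebra_product F m := {bilinear 'rV[F]_m -> 'rV[F]_m -> 'rV[F]_m}.

Definition has_structure_constants (F : fieldType) (m : nat)
    (P : algebra_product F m) (c : cubic F m) : Prop :=
  forall i j : 'I_m,
    P (delta_mx 0 i) (delta_mx 0 j) =
    \sum_(k < m) (c (i, j, k) : F) *: (delta_mx 0 k : 'rV[F]_m).

Definition is_flow_of_algebras (R : realType) (F : fieldType) (m : nat)
    (mu : multiplication F m) (M : R -> R -> cubic F m)
    (P : R -> R -> algebra_product F m) : Prop :=
  Kolmogorov_Chapman mu M /\
  forall s t : R, 0 <= s -> s <= t -> has_structure_constants (P s t) (M s t).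

(* The family P exists for every M and its values at 0 <= s <= t are determined
   by M, so this holds exactly when M satisfies the Kolmogorov-Chapman
   equation. *)
Definition generates_FA (R : realType) (F : fieldType) (m : nat)
    (mu : multiplication F m) (M : R -> R -> cubic F m) : Prop :=
  exists P : R -> R -> algebra_product F m, is_flow_of_algebras mu M P.

(* Main.v *)
Require Import Defs.
From HB Require Import structures.
From mathcomp Require Import all_boot all_order all_algebra sesquilinear.
From mathcomp Require Import boolp classical_sets reals.

Import Order.POrderTheory GRing.Theory.
Local Open Scope ring_scope.

(** The equation telescopes: by associativity, the product of [M s tau] and [M tau t] has in its
    middle the inverse of [A tau] times [A tau], which is the unit matrix. The algebras themselves
    impose no condition on [M]: by [structure_productP] every cubic matrix is the array of structure
    constants of a bilinear product. *)

(** The matrix is that of right multiplication by [y]: its row [i] holds the coordinates of the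
    product of the [i]-th basis vector with [y]. *)
Definition structure_product {F : fieldType} {m : nat} (c : cubic F m)
    (x y : 'rV[F]_m) : 'rV[F]_m :=
  x *m \matrix_(i, k) \sum_j y 0 j * c (i, j, k).

Lemma structure_product_bilinear {F : fieldType} {m : nat} (c : cubic F m) :
  bilinear_for (GRing.Scale.Law.clone _ _ *:%R _)
    (GRing.Scale.Law.clone _ _ *:%R _) (structure_product c).
Proof.
split=> [y|x] a u v; first by rewrite /structure_product mulmxDl -scalemxAl.
rewrite /structure_product /= scalemxAr -mulmxDr; congr (_ *m _).
apply/matrixP=> i k; rewrite !mxE mulr_sumr -big_split /=.
by apply: eq_bigr => j _; rewrite !mxE mulrDl mulrA.
Qed.

HB.instance Definition _ (F : fieldType) (m : nat) (c : cubic F m) :=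
  bilinear_isBilinear.Build F 'rV[F]_m 'rV[F]_m 'rV[F]_m *:%R *:%R
    (structure_product c) (structure_product_bilinear c).

Lemma structure_productP {F : fieldType} {m : nat} (c : cubic F m) :
  has_structure_constants (structure_product c : algebra_product F m) c.
Proof.
move=> i j; rewrite /= /structure_product -rowE.
rewrite [LHS]row_sum_delta; apply: eq_bigr => k _; congr (_ *: _).
(* As [y] is the [j]-th basis vector, only the term of index [j] survives. *)
rewrite !mxE (bigD1 j) //= mxE !eqxx mul1r big1 ?addr0 // => j' /negPf ne_j'j.
by rewrite mxE ne_j'j mul0r.
Qed.

(** Existence of some inverse excludes the default value 0 of [xget]. *)
Lemma is_inverse_inverse {F : fieldType} {m : nat} {mu : multiplication F m}
    {I A : cubic F m} :
  invertible mu I A -> is_inverse mu I A (inverse mu I A).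
Proof. by move=> A_inv; apply: (xgetPex 0 A_inv). Qed.

Theorem theorem2 (R : realType) (F : fieldType) (m : nat)
    (mu : multiplication F m) (I : cubic F m)
    (mu_assoc : associative mu) (mu_unital : is_unit_matrix mu I)
    (A : R -> cubic F m)
    (A_inv : forall t : R, 0 <= t -> invertible mu I (A t)) :
  generates_FA mu (fun s t : R => mu (A s) (inverse mu I (A t))).
Proof.
set M := fun s t : R => mu (A s) (inverse mu I (A t)).
exists (fun s t => structure_product (M s t) : algebra_product F m).
split=> [s tau t s_ge0 s_tau tau_t|s t _ _]; last exact: structure_productP.
(* Invertibility is given at nonnegative times only; the matrix to cancel is [A tau]. *)
have tau_ge0 : 0 <= tau := le_trans s_ge0 (ltW s_tau).
have [_ VA] := is_inverse_inverse (A_inv tau tau_ge0).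
(* Rebracketing twice brings the inverse of [A tau] next to [A tau]. *)
by rewrite /M -mu_assoc [mu (inverse _ _ _) (mu _ _)]mu_assoc VA mu_unital.1.
Qed.
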